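(* Let $R\subseteq\mathbb{R}$ be a subring and $S\subseteq\mathbb{R}_{>0}$ a non-trivial exponential $R$-module, let $A=\mathbb{R}_{>0}^n$ be the $n$-dimensional affine $R_S$-PL space with coordinates $t_1,\dots,t_n$, and let $L=S\oplus\big(\bigoplus_{i=1}^nt_i^R\big)$ be the group of $R_S$-monomial functions on $A$. Then for any point $x\in A_G$ the stalk $\mathcal{O}^\circ_{A_G,x}$ (viewed as the set of elements of $L$ whose germ at $x$ belongs to the stalk) is a bounded valuation $R_+$-monoid of $L$, and this establishes a one-to-one correspondence between the points of $A_G$ and the (equivalence classes of) bounded $R_S$-valuations on $L$.
   Context: $S$ being an exponential $R$-module means that $S$ is a multiplicative subgroup of $\mathbb{R}_{>0}$ closed under $s\mapsto s^r$, $r\in R$. An $R_S$-polytope in $A$ is a compact subset given by finitely many inequalities $st_1^{e_1}\cdots t_n^{e_n}\le1$ with $s\in S$, $e_i\in R$. A subset $U\subseteq A$ is an $R_S$-PL subspace if the $R_S$-polytopes contained in $U$ form a quasi-net on $U$ (every point of $U$ has a neighborhood in $U$ that is a finite union of such polytopes each containing the point), and a covering $U=\bigcup_iU_i$ by $R_S$-PL subspaces is admissible if $\{U_i\}$ is a quasi-net of $U$. $A_G$ denotes this $G$-topology and also its topological realization: its points are the completely prime filters of $R_S$-PL subspaces (non-empty proper upward closed families, closed under finite intersections, not containing $\emptyset$, and containing some member of each admissible covering of each of their members). An $R_S$-PL function is one which is locally, on the members of a quasi-net of $R_S$-polytopes, given by an element of $L$. $\mathcal{O}^\circ_A$ is the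 sheaf on $A_G$ whose sections over an $R_S$-polyhedron $P$ are the $R_S$-PL functions on $P$ with values in $(0,1]$; the stalk at $x$ is the colimit over $R_S$-PL subspaces in the filter $x$. Let $R_+=R\cap\mathbb{R}_{\ge0}$. An $R_S$-valuation on $L$ is a homomorphism $|\ |:L\to\Gamma$ to an ordered (multiplicative abelian) group such that $|x^r|\le1$ whenever $r\in R_+$, $x\in L$, $|x|\le1$, and such that the restriction of $|\ |$ to $S$ is equivalent to the embedding $S\hookrightarrow\mathbb{R}_{>0}$. It is bounded if for any $x\in L$ there is $s\in S$ with $|x|\le|s|$. It is determined up to equivalence by its valuation monoid $L^\circ=\{x\in L:|x|\le1\}$. The submonoids $L^\circ\subseteq L$ arising from bounded $R_S$-valuations are called bounded valuation $R_+$-monoids of $L$; they contain $S\cap(0,1]$, are closed under the action of $R_+$, and satisfy $(L^\circ)^{\mathrm{gp}}=L$ and $SL^\circ=L$. *)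

(* Defs.v *)
From HB Require Import structures.
From mathcomp Require Import all_boot all_order all_algebra.
From mathcomp Require Import all_classical all_reals all_analysis.

Set Implicit Arguments.
Unset Strict Implicit.
Unset Printing Implicit Defensive.

Import Order.TTheory GRing.Theory Num.Theory.
Import numFieldNormedType.Exports.

Local Open Scope classical_set_scope.
Local Open Scope ring_scope.

(* Multiplicative ordered abelian groups. *)
HB.mixin Record isOrderedAbelianGroup (d : Order.disp_t) (G : Type)
    of Group G & Order.Total d G := {
  oag_mulC : forall x y : G, (x * y = y * x)%g;
  oag_leM2r : forall z x y : G, (x <= y)%O -> (x * z <= y * z)%O%g
}.

#[short(type="orderedAbelianGroupType")]
HB.structure Definition OrderedAbelianGroup (d : Order.disp_t) :=
  {G of isOrderedAbelianGroup d G & Group G & Order.Total d G}.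

Record expModule (K : realType) (R : subringClosed K) := ExpModule {
  expModule_pred :> {pred K};
  expModule_gt0 : forall s, s \in expModule_pred -> 0 < s;
  expModule1 : 1 \in expModule_pred;
  expModuleM : {in expModule_pred &, forall s s', s * s' \in expModule_pred};
  expModuleV : {in expModule_pred, forall s, s^-1 \in expModule_pred};
  expModuleX : {in expModule_pred, forall s r,
    r \in R -> s `^ r \in expModule_pred}
}.

Section Monomials.
Context {K : realType} {R : subringClosed K}.
Variables (S : expModule R) (n : nat).

(* The pair (s, e) stands for the monomial s t_1^{e_1} ... t_n^{e_n}. Distinct
   pairs give distinct functions on the positive orthant. *)
Definition is_monomial (p : K * 'rV[K]_n) : bool :=
  (p.1 \in S) && (p.2 \is a mxOver R).

Record monomial := Monomial {
  monomial_val : K * 'rV[K]_n;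
  monomialP : is_monomial monomial_val
}.

HB.instance Definition _ := [isSub for monomial_val].
HB.instance Definition _ := [Choice of monomial by <:].

Lemma monomial_const_subproof (s : {s : K | s \in S}) :
  is_monomial (val s, 0).
Proof. by rewrite /is_monomial /= (valP s) rpred0. Qed.

Definition monomial_const (s : {s : K | s \in S}) : monomial :=
  Monomial (monomial_const_subproof s).

Lemma monomial_one_subproof : is_monomial (1, 0).
Proof. by rewrite /is_monomial /= expModule1 rpred0. Qed.

Lemma monomial_inv_subproof (m : monomial) :
  is_monomial ((val m).1^-1, - (val m).2).
Proof.
by case/andP: (valP m) => sm em; rewrite /is_monomial /= expModuleV // rpredN.
Qed.

Lemma monomial_mul_subproof (m m' : monomial) :
  is_monomial ((val m).1 * (val m').1, (val m).2 + (val m').2).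
Proof.
case/andP: (valP m) => sm em; case/andP: (valP m') => sm' em'.
by rewrite /is_monomial /= expModuleM // rpredD.
Qed.

Lemma monomial_pow_subproof (r : K) (m : monomial) : r \in R ->
  is_monomial ((val m).1 `^ r, r *: (val m).2).
Proof.
move=> Rr; case/andP: (valP m) => sm em; rewrite /is_monomial /= expModuleX //=.
by apply/mxOverP => i j; rewrite mxE rpredM //; move/mxOverP: em; apply.
Qed.

Definition monomial_one : monomial := Monomial monomial_one_subproof.
Definition monomial_inv (m : monomial) : monomial :=
  Monomial (monomial_inv_subproof m).
Definition monomial_mul (m m' : monomial) : monomial :=
  Monomial (monomial_mul_subproof m m').
Definition monomial_pow (r : K) (Rr : r \in R) (m : monomial) : monomial :=
  Monomial (monomial_pow_subproof m Rr).

Lemma monomial_mulA : associative monomial_mul.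
Proof. by move=> x y z; apply: val_inj; rewrite /= mulrA addrA. Qed.
Lemma monomial_mul1 : left_id monomial_one monomial_mul.
Proof. by move=> [[s e] p]; apply: val_inj; rewrite /= mul1r add0r. Qed.
Lemma monomial_1mul : right_id monomial_one monomial_mul.
Proof. by move=> [[s e] p]; apply: val_inj; rewrite /= mulr1 addr0. Qed.
Lemma monomial_neq0 (m : monomial) : (val m).1 != 0.
Proof. by case/andP: (valP m) => /expModule_gt0 /lt0r_neq0. Qed.
Lemma monomial_mulV : left_inverse monomial_one monomial_inv monomial_mul.
Proof.
by move=> m; apply: val_inj; rewrite /= addNr mulVf // monomial_neq0.
Qed.
Lemma monomial_Vmul : right_inverse monomial_one monomial_inv monomial_mul.
Proof.
by move=> m; apply: val_inj; rewrite /= addrN mulfV // monomial_neq0.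
Qed.

HB.instance Definition _ := isGroup.Build monomial
  monomial_mulA monomial_mul1 monomial_1mul monomial_mulV monomial_Vmul.

Definition monomial_fun (m : monomial) (t : 'rV[K]_n) : K :=
  (val m).1 * \prod_(i < n) (t ord0 i `^ (val m).2 ord0 i).

End Monomials.
Arguments monomial_const {K R S} n s.

(* Functions on subsets of the space are represented by total functions on
   'rV[K]_n, only their values on the relevant subset being meaningful. *)
Section PLSpace.
Context {K : realType} {R : subringClosed K}.
Variables (S : expModule R) (n : nat).

Local Notation V := 'rV[K]_n.
Local Notation L := (monomial S n).

Definition affine_space : set V := [set t | forall i, 0 < t ord0 i].

Definition polytope (P : set V) : Prop :=
  compact P /\ exists F : seq L,
    P = affine_space `&`
        [set t | forall m, m \in F -> monomial_fun m t <= 1].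

(* [within U (nbhs t) X] says that X contains a neighborhood of t in U. *)
Definition quasi_net (U : set V) (D : set (set V)) : Prop :=
  (forall W, D W -> W `<=` U) /\
  forall t, U t -> exists F : set (set V),
    [/\ finite_set F, F `<=` D, (forall W, F W -> W t)
      & within U (nbhs t) (\bigcup_(W in F) W)].

Definition PL_subspace (U : set V) : Prop :=
  U `<=` affine_space /\ quasi_net U [set P | polytope P /\ P `<=` U].

Definition admissible_covering (U : set V) (D : set (set V)) : Prop :=
  [/\ D `<=` PL_subspace, \bigcup_(W in D) W = U & quasi_net U D].

(* The points of the G-topological space, each one being a set of PL subspaces. *)
Record AG_point (x : set (set V)) : Prop := {
  AG_point_PL : x `<=` PL_subspace;
  AG_point_nonempty : x !=set0;
  AG_point_proper : ~ x set0;
  AG_point_up : forall U W, x U -> PL_subspace W -> U `<=` W -> x W;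
  AG_pointI : forall U W, x U -> x W -> x (U `&` W);
  AG_point_covering : forall U D, x U -> admissible_covering U D ->
    exists2 W, D W & x W
}.

Definition PL_function (U : set V) (f : V -> K) : Prop :=
  quasi_net U [set P | [/\ polytope P, P `<=` U
    & exists m : L, forall t, P t -> f t = monomial_fun m t]].

(* The sheaf is determined by its sections over polyhedra; by gluing, its
   sections over an arbitrary PL subspace U are given by the same formula. *)
Definition Ocirc (U : set V) : set (V -> K) :=
  [set f | PL_function U f /\ forall t, U t -> 0 < f t <= 1].

(* The germ at x of f on U, as the class of all functions g.2 on members g.1 of
   the filter x that coincide with f on some smaller member of x. *)
Definition germ (x : set (set V)) (U : set V) (f : V -> K) :
    set (set V * (V -> K)) :=
  [set g | x g.1 /\ exists W, [/\ x W, W `<=` U, W `<=` g.1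
    & forall t, W t -> f t = g.2 t]].

(* The colimit over the members U of x, as a set of germs. *)
Definition stalk (F : set V -> set (V -> K)) (x : set (set V)) :
    set (set (set V * (V -> K))) :=
  [set c | exists U f, [/\ x U, F U f & c = germ x U f]].

(* A monomial is sent to its germ at x; the map need not be injective, and
   [stalk_monoid x] is the preimage of the stalk under it. *)
Definition stalk_monoid (x : set (set V)) : set L :=
  [set m | stalk Ocirc x (germ x affine_space (monomial_fun m))].

End PLSpace.
Arguments stalk_monoid {K R} S {n} x.

(* Two maps to ordered groups are equivalent when they induce the same
   comparison relation on the source, equivalently when their images are
   isomorphic as ordered groups compatibly with the maps. *)
Definition val_equiv (T : Type) (d d' : Order.disp_t)
    (G : porderType d) (G' : porderType d') (v : T -> G) (w : T -> G') : Prop :=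
  forall x y, (v x <= v y)%O = (w x <= w y)%O.

Section Valuations.
Context {K : realType} {R : subringClosed K}.
Variables (S : expModule R) (n : nat).

Local Notation L := (monomial S n).

Definition RS_valuation (d : Order.disp_t) (G : orderedAbelianGroupType d)
    (v : {multiplicative L -> G}) : Prop :=
  (forall (r : K) (Rr : r \in R) (m : L), 0 <= r ->
     (v m <= 1%g)%O -> (v (monomial_pow Rr m) <= 1%g)%O) /\
  val_equiv (fun s : {s : K | s \in S} => v (monomial_const n s))
            (fun s : {s : K | s \in S} => val s).

Definition bounded_valuation (d : Order.disp_t) (G : orderedAbelianGroupType d)
    (v : {multiplicative L -> G}) : Prop :=
  forall m : L, exists s : {s : K | s \in S}, (v m <= v (monomial_const n s))%O.

Record bounded_RS_valuation := BoundedRSValuation {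
  bv_disp : Order.disp_t;
  bv_group : orderedAbelianGroupType bv_disp;
  bv_fun :> {multiplicative L -> bv_group};
  bv_RS : RS_valuation bv_fun;
  bv_bounded : bounded_valuation bv_fun
}.

Definition valuation_monoid (v : bounded_RS_valuation) : set L :=
  [set m | (v m <= 1%g)%O].

Definition bounded_valuation_monoid (M : set L) : Prop :=
  exists v : bounded_RS_valuation, M = valuation_monoid v.

Definition valuation_class (v : bounded_RS_valuation) :
    set bounded_RS_valuation :=
  [set w : bounded_RS_valuation | val_equiv v w].

End Valuations.

(* Main.v *)
(* A point [x] of the space is determined by the monoid M of monomials [m] such
   that the half-space [m <= 1] belongs to [x]: a member of [x] contains a
   polytope of [x], and a polytope is a finite intersection of half-spaces. The
   half-spaces [m <= 1] and [m^-1 <= 1] form an admissible covering, so M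
   contains [m] or [m^-1], and the value group is the quotient of the monomials
   by the units of M.
   Conversely, a bounded valuation v defines the filter generated by the
   polytopes cut out by monomials of value at most 1. That it is completely prime
   is Farkas' lemma with exponents in R. Let such a polytope be covered by
   finitely many polytopes, none of which is in the filter. Each of the latter has
   a defining monomial [m_j] with v(m_j) > 1, and the inequalities [m <= 1] of the
   former are incompatible with all the [m_j > 1]. Eliminating the coordinates
   yields a constant monomial on which v and the order of K disagree. *)
From HB Require Import structures.
From mathcomp Require Import all_boot all_order all_algebra.
From mathcomp Require Import all_classical all_reals all_analysis.
From mathcomp Require Import lra.
Require Import Defs.

Set Implicit Arguments.
Unset Strict Implicit.
Unset Printing Implicit Defensive.

Import Order.TTheory GRing.Theory Num.Theory.
Import numFieldNormedType.Exports.

Local Open Scope classical_set_scope.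
Local Open Scope ring_scope.

(** * The value group of a valuation monoid *)

(* The carrier of a group in [orderedAbelianGroupType] lies in a universe
   strictly below the one of matrices, hence of monomials. So the value group of
   a valuation cannot be a quotient type of the monomials: its elements are the
   codes, in a smaller type [C], of canonical representatives. *)
Record total_submonoid (L : groupType) (C : Type) := TotalSubmonoid {
  ts_set :> L -> Prop;
  ts_mulC : forall x y : L, (x * y = y * x)%g;
  ts_mul : forall x y, ts_set x -> ts_set y -> ts_set (x * y)%g;
  ts_total : forall x, ts_set x \/ ts_set (x^-1)%g;
  ts_code : L -> C;
  ts_code_inj : injective ts_code
}.

Section TotalSubmonoidQuotient.
Variables (L : groupType) (C : Type) (M : total_submonoid L C).
Implicit Types x y z : L.

Let ts_1 : M 1%g.
Proof. by case: (ts_total M 1%g); rewrite ?invg1. Qed.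

(** [M] is to become the set of elements at most 1 of an ordered quotient, which forces this
    preorder on [L]; the quotient identifies elements that are comparable both ways. *)
Definition ts_le x y : bool := `[< M (x / y)%g >].
Definition ts_equiv x y : bool := ts_le x y && ts_le y x.

Lemma ts_le_refl : reflexive ts_le.
Proof. by move=> x; apply/asboolP; rewrite mulgV. Qed.

Lemma ts_le_trans : transitive ts_le.
Proof.
move=> y x z /asboolP xy /asboolP yz; apply/asboolP.
by rewrite -(divgKA y); exact: ts_mul.
Qed.

Lemma ts_le_total : total ts_le.
Proof.
move=> x y; apply/orP; rewrite /ts_le.
by case: (ts_total M (x / y)%g) => [|/[!invgF]] ?; [left|right]; exact/asboolP.
Qed.

Lemma ts_leM2r z x y : ts_le (x * z)%g (y * z)%g = ts_le x y.
Proof. by rewrite /ts_le mulgKA. Qed.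

Lemma ts_leM x y x' y' : ts_le x y -> ts_le x' y' ->
  ts_le (x * x')%g (y * y')%g.
Proof.
move=> xy xy'; apply: (@ts_le_trans (y * x')%g); first by rewrite ts_leM2r.
by rewrite !(ts_mulC M y) ts_leM2r.
Qed.

Lemma ts_leV x y : ts_le (x^-1)%g (y^-1)%g = ts_le y x.
Proof. by rewrite /ts_le invgK (ts_mulC M). Qed.

Lemma ts_equiv_refl : reflexive ts_equiv.
Proof. by move=> x; rewrite /ts_equiv ts_le_refl. Qed.

Lemma ts_equiv_sym : symmetric ts_equiv.
Proof. by move=> x y; rewrite /ts_equiv andbC. Qed.

Lemma ts_equiv_trans : transitive ts_equiv.
Proof.
move=> y x z /andP[xy yx] /andP[yz zy]; apply/andP.
by split; apply: ts_le_trans; eassumption.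
Qed.

(** [xget] chooses from the class of [x] as a set, so equivalent elements get the same choice. The
    default [1] is never resorted to, since the class contains [x]. *)
Definition ts_canon x : L := xget 1%g [set y | ts_equiv x y].

Lemma ts_canonP x : ts_equiv x (ts_canon x).
Proof.
have := @xgetPex _ 1%g [set y | ts_equiv x y]; apply; exists x.
exact: ts_equiv_refl.
Qed.

Lemma ts_canon_eq x y : ts_equiv x y -> ts_canon x = ts_canon y.
Proof.
move=> xy; congr xget; apply/seteqP; split => z /=; apply: ts_equiv_trans => //.
by rewrite ts_equiv_sym.
Qed.

Definition ts_quot : Type :=
  {c : C | `[< exists x, c = ts_code M (ts_canon x) >]}.
HB.instance Definition _ := gen_eqMixin ts_quot.
HB.instance Definition _ := gen_choiceMixin ts_quot.

Definition ts_pi x : ts_quot :=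
  exist _ (ts_code M (ts_canon x)) (asboolT (ex_intro _ x erefl)).

Lemma ts_quotP x y : ts_pi x = ts_pi y <-> ts_equiv x y.
Proof.
split => [[/ts_code_inj xy]|/ts_canon_eq xy]; last exact/eq_exist/congr1.
by rewrite (ts_equiv_trans (ts_canonP x))// xy ts_equiv_sym ts_canonP.
Qed.

Let pi_surj (a : ts_quot) : exists x, a = ts_pi x.
Proof.
by case: a => c ac; have /asboolP[x cE] := ac; exists x; exact/eq_exist.
Qed.

Definition ts_repr (a : ts_quot) : L := projT1 (cid (pi_surj a)).

Lemma ts_reprK : cancel ts_repr ts_pi.
Proof. by move=> a; rewrite /ts_repr; case: cid. Qed.

Let piP x : ts_equiv (ts_repr (ts_pi x)) x.
Proof. by apply/ts_quotP; rewrite ts_reprK. Qed.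

Definition ts_quot_mul (a b : ts_quot) : ts_quot :=
  (ts_pi (ts_repr a * ts_repr b)%g).
Definition ts_quot_inv (a : ts_quot) : ts_quot := (ts_pi (ts_repr a)^-1%g).
Definition ts_quot_one : ts_quot := (ts_pi 1%g).
Definition ts_quot_le (a b : ts_quot) : bool := ts_le (ts_repr a) (ts_repr b).

Lemma ts_quot_pi_mul x y :
  ts_quot_mul (ts_pi x) (ts_pi y) = (ts_pi (x * y)%g).
Proof.
have /andP[x1 x2] := piP x; have /andP[y1 y2] := piP y.
by apply/ts_quotP; rewrite /ts_equiv !ts_leM.
Qed.

Lemma ts_quot_pi_inv x : ts_quot_inv (ts_pi x) = (ts_pi x^-1%g).
Proof.
have /andP[x1 x2] := piP x.
by apply/ts_quotP; rewrite /ts_equiv !ts_leV x1 x2.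
Qed.

Lemma ts_quot_pi_le x y : ts_quot_le (ts_pi x) (ts_pi y) = ts_le x y.
Proof.
have /andP[x1 x2] := piP x; have /andP[y1 y2] := piP y.
apply/idP/idP => [|xy].
  by move/(ts_le_trans x2)/ts_le_trans; exact.
exact: ts_le_trans (ts_le_trans x1 xy) y2.
Qed.

Lemma ts_quot_mulA : associative ts_quot_mul.
Proof.
move=> a b c.
have [[x ->] [y ->] [z ->]] := And3 (pi_surj a) (pi_surj b) (pi_surj c).
by rewrite !ts_quot_pi_mul mulgA.
Qed.

Lemma ts_quot_mulC : commutative ts_quot_mul.
Proof.
move=> a b; have [[x ->] [y ->]] := conj (pi_surj a) (pi_surj b).
by rewrite !ts_quot_pi_mul (ts_mulC M).
Qed.

Lemma ts_quot_mul1 : left_id ts_quot_one ts_quot_mul.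
Proof. by move=> a; have [x ->] := pi_surj a; rewrite ts_quot_pi_mul mul1g. Qed.

Lemma ts_quot_1mul : right_id ts_quot_one ts_quot_mul.
Proof. by move=> a; rewrite ts_quot_mulC ts_quot_mul1. Qed.

Lemma ts_quot_mulV : left_inverse ts_quot_one ts_quot_inv ts_quot_mul.
Proof.
move=> a; have [x ->] := pi_surj a.
by rewrite ts_quot_pi_inv ts_quot_pi_mul mulVg.
Qed.

Lemma ts_quot_Vmul : right_inverse ts_quot_one ts_quot_inv ts_quot_mul.
Proof. by move=> a; rewrite ts_quot_mulC ts_quot_mulV. Qed.

HB.instance Definition _ := isGroup.Build ts_quot ts_quot_mulA
  ts_quot_mul1 ts_quot_1mul ts_quot_mulV ts_quot_Vmul.

Lemma ts_quot_le_refl : reflexive ts_quot_le.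
Proof. by move=> a; exact: ts_le_refl. Qed.

Lemma ts_quot_le_anti : antisymmetric ts_quot_le.
Proof.
move=> a b; have [[x ->] [y ->]] := conj (pi_surj a) (pi_surj b).
by rewrite !ts_quot_pi_le => xy; apply/ts_quotP.
Qed.

Lemma ts_quot_le_trans : transitive ts_quot_le.
Proof. by move=> a b c; exact: ts_le_trans. Qed.

Lemma ts_quot_le_total : total ts_quot_le.
Proof. by move=> a b; exact: ts_le_total. Qed.

HB.instance Definition _ := Order.Le_isPOrder.Build (Order.Disp tt tt) ts_quot
  ts_quot_le_refl ts_quot_le_anti ts_quot_le_trans.
HB.instance Definition _ :=
  Order.POrder_isTotal.Build (Order.Disp tt tt) ts_quot ts_quot_le_total.

Lemma ts_quot_leM2r (c a b : ts_quot) :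
  ts_quot_le a b -> ts_quot_le (ts_quot_mul a c) (ts_quot_mul b c).
Proof.
have [[x ->] [y ->] [z ->]] := And3 (pi_surj a) (pi_surj b) (pi_surj c).
by rewrite !ts_quot_pi_mul !ts_quot_pi_le ts_leM2r.
Qed.

HB.instance Definition _ := isOrderedAbelianGroup.Build (Order.Disp tt tt)
  ts_quot ts_quot_mulC ts_quot_leM2r.

Lemma ts_piM : {morph ts_pi : x y / (x * y)%g}.
Proof. by move=> x y; rewrite [RHS]ts_quot_pi_mul. Qed.

HB.instance Definition _ := isMultiplicative.Build L ts_quot ts_pi ts_piM.

Lemma ts_pi_le x y : (ts_pi x <= ts_pi y)%O = ts_le x y.
Proof. by rewrite /Order.le /= ts_quot_pi_le. Qed.

(** Recovers [M] from the quotient map; through this the valuation attached to a point has the stalk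
    as its valuation monoid. *)
Lemma ts_pi_le1 x : (ts_pi x <= 1%g)%O <-> M x.
Proof.
have -> : (1 = ts_pi 1)%g by [].
by rewrite ts_pi_le /ts_le invg1 mulg1; split => [/asboolP|/asboolP].
Qed.

End TotalSubmonoidQuotient.

(** * Farkas' lemma for monomial inequalities *)

Lemma seq_argmin (F : realFieldType) (T : eqType) (f : T -> F) (x : T)
    (s : seq T) :
  exists2 y, y \in x :: s & forall z, z \in x :: s -> f y <= f z.
Proof.
elim: s x => [|a s IH] x.
  by exists x; rewrite ?mem_head// => z; rewrite inE => /eqP ->.
have [y ys ymin] := IH a.
have [xy|yx] := leP (f x) (f y).
  exists x; rewrite ?mem_head// => z; rewrite inE => /orP[/eqP ->//|/ymin].
  exact: le_trans.
exists y; first by rewrite inE ys orbT.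
by move=> z; rewrite inE => /orP[/eqP ->|/ymin//]; exact: ltW.
Qed.

(** The one-variable case of elimination; the booleans mark the non-strict bounds. The midpoint of
    the largest lower and the smallest upper bound works: a strict lower bound is below every upper
    bound and at most the largest lower one, hence strictly below the midpoint, and dually. *)
Lemma separating_value (F : realFieldType) (lo up : seq (bool * F)) :
  (forall l u, l \in lo -> u \in up -> l.2 < u.2 ?<= if l.1 && u.1) ->
  exists z : F, (forall l, l \in lo -> l.2 < z ?<= if l.1) /\
    (forall u, u \in up -> z < u.2 ?<= if u.1).
Proof.
move=> lu.
case: lo => [|l0 lo] in lu *.
  case: up => [|u0 up] in lu *; first by exists 0; split.
  have [u _ umin] := seq_argmin snd u0 up.
  exists (u.2 - 1); split => // u' /umin uu'; apply: lteifS.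
  by rewrite (lt_le_trans _ uu')// ltrBlDr ltrDl.
have [l ls lmax] := seq_argmin (fun p : bool * F => - p.2) l0 lo.
case: up => [|u0 up] in lu *.
  exists (l.2 + 1); split => // l' /lmax; rewrite lerN2 => ll'; apply: lteifS.
  by rewrite (le_lt_trans ll')// ltrDl.
have [u us umin] := seq_argmin snd u0 up.
exists ((l.2 + u.2) / 2); split.
  move=> l' l's; have := lmax _ l's; rewrite lerN2 => ll'.
  have := lu _ _ l's us; have := lteifW (lu _ _ ls us).
  by case: l'.1 => /=; [move=> ? /lteifW ?|]; lra.
move=> u' u's; have uu' := umin _ u's.
have := lu _ _ ls u's; have := lteifW (lu _ _ ls us).
by case: u'.1 => /=; [move=> ? /lteifW ?|rewrite andbF /=]; lra.
Qed.

(** * Monomials in logarithmic coordinates and Fourier-Motzkin elimination *)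

Section MonomialFunctions.
Context {K : realType} {R : subringClosed K}.
Variables (S : expModule R) (n : nat).
Local Notation V := 'rV[K]_n.
Local Notation L := (monomial S n).
Implicit Types (m : L) (t y : V).

Lemma monomial_mulgC m m' : (m * m' = m' * m)%g.
Proof. by apply: val_inj; rewrite /= mulrC addrC. Qed.

Lemma monomial_coef_gt0 m : 0 < (val m).1.
Proof. by case/andP: (valP m) => /expModule_gt0. Qed.

Lemma monomial_exponent m i : (val m).2 ord0 i \in R.
Proof. by case/andP: (valP m) => _ /mxOverP. Qed.

(** The logarithm of the monomial function in the coordinates [y_i = ln t_i]. It is affine in [y],
    so monomial inequalities become linear ones. *)
Definition log_monomial m y : K :=
  ln (val m).1 + \sum_(i < n) (val m).2 ord0 i * y ord0 i.

Lemma log_monomialM m m' y :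
  log_monomial (m * m')%g y = log_monomial m y + log_monomial m' y.
Proof.
rewrite /log_monomial /= lnM ?posrE ?monomial_coef_gt0//.
rewrite [RHS]addrACA -big_split /=.
by congr (_ + _); apply: eq_bigr => i _; rewrite mxE mulrDl.
Qed.

Lemma log_monomialV m y : log_monomial m^-1%g y = - log_monomial m y.
Proof.
rewrite /log_monomial /= lnV ?posrE ?monomial_coef_gt0// opprD -sumrN.
by congr (_ + _); apply: eq_bigr => i _; rewrite mxE mulNr.
Qed.

Lemma log_monomialX r (Rr : r \in R) m y :
  log_monomial (monomial_pow Rr m) y = r * log_monomial m y.
Proof.
rewrite /log_monomial /= ln_powR mulrDr big_distrr /=.
by congr (_ + _); apply: eq_bigr => i _; rewrite mxE mulrA.
Qed.

Lemma log_monomial_shift m y z i :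
  log_monomial m (y + z *: delta_mx ord0 i) =
  log_monomial m y + z * (val m).2 ord0 i.
Proof.
rewrite /log_monomial -addrA; congr (_ + _).
under eq_bigr do rewrite !mxE eqxx /= mulrDr.
rewrite big_split /=; congr (_ + _).
rewrite (bigD1 i)//= eqxx mulr1 mulrC big1 ?addr0// => j /negPf ->.
by rewrite !mulr0.
Qed.

Lemma log_monomial_const m y : (val m).2 = 0 -> log_monomial m y = ln (val m).1.
Proof.
rewrite /log_monomial => ->; rewrite big1 ?addr0// => i _.
by rewrite mxE mul0r.
Qed.

Lemma monomial_funE m t : affine_space t ->
  monomial_fun m t = expR (log_monomial m (\row_i ln (t ord0 i))).
Proof.
move=> At; rewrite /log_monomial expRD lnK ?posrE ?monomial_coef_gt0//.
rewrite expR_sum; congr (_ * _); apply: eq_bigr => i _.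
by rewrite mxE /powR gt_eqF//; exact: At.
Qed.

Lemma affine_exp y : affine_space (\row_i expR (y ord0 i)).
Proof. by move=> i; rewrite mxE expR_gt0. Qed.

Lemma monomial_fun_exp m y :
  monomial_fun m (\row_i expR (y ord0 i)) = expR (log_monomial m y).
Proof.
rewrite monomial_funE; last exact: affine_exp.
by congr (expR (log_monomial _ _)); apply/rowP => i; rewrite !mxE expRK.
Qed.

Lemma monomial_fun_gt0 m t : affine_space t -> 0 < monomial_fun m t.
Proof. by move=> At; rewrite monomial_funE// expR_gt0. Qed.

Lemma monomial_funM m m' t : affine_space t ->
  monomial_fun (m * m')%g t = monomial_fun m t * monomial_fun m' t.
Proof. by move=> At; rewrite !monomial_funE// log_monomialM expRD. Qed.

Lemma monomial_funV m t : affine_space t ->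
  monomial_fun m^-1%g t = (monomial_fun m t)^-1.
Proof. by move=> At; rewrite !monomial_funE// log_monomialV expRN. Qed.

Lemma monomial_funX r (Rr : r \in R) m t : affine_space t ->
  monomial_fun (monomial_pow Rr m) t = monomial_fun m t `^ r.
Proof.
by move=> At; rewrite !monomial_funE// log_monomialX mulrC expRM.
Qed.

Lemma monomial_fun_const s t :
  monomial_fun (monomial_const n s : L) t = val s.
Proof.
rewrite /monomial_fun /= big1 ?mulr1// => i _.
by rewrite mxE powRr0.
Qed.

(** Each monomial is raised to the exponent of [t_i] in the other one, up to sign, so that [t_i]
    cancels. Both powers are positive when the exponent is positive in [p] and negative in [q]. *)
Definition monomial_elim i (p q : bool * L) : bool * L :=
  (p.1 && q.1,
   monomial_pow (monomial_exponent p.2 i) q.2 *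
   monomial_pow (rpredNr (monomial_exponent q.2 i)) p.2)%g.

Lemma log_monomial_elim i p q y :
  log_monomial (monomial_elim i p q).2 y =
  (val p.2).2 ord0 i * log_monomial q.2 y -
  (val q.2).2 ord0 i * log_monomial p.2 y.
Proof. by rewrite log_monomialM !log_monomialX mulNr. Qed.

(* Fourier-Motzkin elimination. It needs no division, so it only multiplies the
   constraints by positive elements of [R]. *)
Lemma monomial_feasible (C : bool -> L -> Prop)
    (CM : forall b b' m m', C b m -> C b' m' -> C (b && b') (m * m')%g)
    (CX : forall b m r (Rr : r \in R), 0 < r -> C b m ->
      C b (monomial_pow Rr m))
    (C1 : forall b m, C b m -> (val m).2 = 0 -> (val m).1 < 1 ?<= if b)
    (s : seq (bool * L)) :
  (forall p, p \in s -> C p.1 p.2) ->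
  exists2 t, affine_space t &
    forall p, p \in s -> monomial_fun p.2 t < 1 ?<= if p.1.
Proof.
move=> sC.
suff [y ys] : exists y, forall p, p \in s -> log_monomial p.2 y < 0 ?<= if p.1.
  exists (\row_i expR (y ord0 i)); first exact: affine_exp.
  move=> p /ys; rewrite monomial_fun_exp -expR0.
  by case: p.1 => /=; rewrite ?ler_expR ?ltr_expR.
(* Induction on the list of coordinates that may still occur in the constraints. Initially it
   contains all of them, so the condition is void. *)
have : forall p, p \in s -> forall i, i \notin enum 'I_n ->
    (val p.2).2 ord0 i = 0.
  by move=> p _ i; rewrite mem_enum.
elim: (enum 'I_n) s sC => [|i I IH] s sC sI.
  exists 0 => p ps; have p0 : (val p.2).2 = 0.
    by apply/rowP => i; rewrite sI// mxE.
  rewrite log_monomial_const//; have := C1 _ _ (sC _ ps) p0.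
  case: p.1 => /= h; first exact: ln_le0.
  by rewrite -ltr_expR expR0 lnK ?posrE ?monomial_coef_gt0.
pose e (p : bool * L) : K := (val p.2).2 ord0 i.
pose s0 := [seq p <- s | e p == 0].
pose sp := [seq p <- s | 0 < e p].
pose sn := [seq p <- s | e p < 0].
have [|p|y ys] := IH (s0 ++ [seq monomial_elim i p q | p <- sp, q <- sn]).
- move=> p; rewrite mem_cat => /orP[|/allpairsP[[p1 p2] /= []]].
    by rewrite mem_filter => /andP[_ /sC].
  rewrite !mem_filter => /andP[e1 /sC C1'] /andP[e2 /sC C2] -> /=.
  by rewrite andbC; apply: CM; apply: CX; rewrite // oppr_gt0.
- rewrite mem_cat => /orP[|/allpairsP[[p1 p2] /= []]].
    rewrite mem_filter => /andP[/eqP ep ps] j jI.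
    have [->//|ji] := eqVneq j i.
    by rewrite sI// inE negb_or; apply/andP.
  rewrite !mem_filter => /andP[e1 s1] /andP[e2 s2] -> j jI /=.
  rewrite !mxE; have [->|ji] := eqVneq j i; first by rewrite mulNr mulrC subrr.
  have jiI : j \notin i :: I by rewrite inE negb_or; apply/andP.
  by rewrite (sI _ s1 _ jiI) (sI _ s2 _ jiI) !mulr0 addr0.
(* At [y] fixed, a constraint [p] bounds the shift [z] of coordinate [i] by
   [- log_monomial p.2 y / e p], from above if [e p > 0] and from below if [e p < 0]. The eliminated
   constraints say that the lower bounds are compatible with the upper ones. *)
have [l u|z [zlo zup]] := separating_value
    (lo := [seq (p.1, - log_monomial p.2 y / e p) | p <- sn])
    (up := [seq (p.1, - log_monomial p.2 y / e p) | p <- sp]).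
  case/mapP => q qs -> /mapP[p ps ->] /=.
  have : monomial_elim i p q \in
      s0 ++ [seq monomial_elim i p q | p <- sp, q <- sn].
    by rewrite mem_cat allpairs_f ?orbT.
  move/ys; rewrite log_monomial_elim /= -/(e p) -/(e q).
  move: qs ps; rewrite !mem_filter => /andP[eq0 _] /andP[ep0 _].
  rewrite andbC lteif_pdivlMr// mulrAC lteif_ndivrMr// !mulNr lteifN2.
  by rewrite subr_lteifr0 ![_ * e _]mulrC.
exists (y + z *: delta_mx ord0 i) => p ps; rewrite log_monomial_shift -/(e p).
have [ep|ep|ep] := ltgtP (e p) 0.
- have /zlo /= : (p.1, - log_monomial p.2 y / e p) \in
      [seq (p.1, - log_monomial p.2 y / e p) | p <- sn].
    by apply: map_f; rewrite mem_filter ep.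
  by rewrite lteif_ndivrMr// => h; rewrite -lteifBrDl sub0r.
- have /zup /= : (p.1, - log_monomial p.2 y / e p) \in
      [seq (p.1, - log_monomial p.2 y / e p) | p <- sp].
    by apply: map_f; rewrite mem_filter ep.
  by rewrite lteif_pdivlMr// => h; rewrite -lteifBrDl sub0r.
rewrite ep mulr0 addr0; apply: ys.
by rewrite mem_cat mem_filter ep eqxx ps.
Qed.

End MonomialFunctions.

(** * Bounded valuations *)

Section OrderedGroup.
Local Open Scope group_scope.
Local Open Scope order_scope.
Context (d : Order.disp_t) (G : orderedAbelianGroupType d).
Implicit Types x y z : G.

Lemma oag_leM2rE z x y : (x * z <= y * z) = (x <= y).
Proof.
apply/idP/idP; last exact: oag_leM2r.
by move/(oag_leM2r z^-1); rewrite !mulgK.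
Qed.

Lemma oag_ltM2rE z x y : (x * z < y * z) = (x < y).
Proof. by rewrite !ltNge oag_leM2rE. Qed.

Lemma oag_lteM2rE z x y b :
  (x * z < y * z ?<= if b) = (x < y ?<= if b).
Proof. by case: b; rewrite /= ?oag_leM2rE ?oag_ltM2rE. Qed.

Lemma oag_div_le1 x y : (x / y <= 1) = (x <= y).
Proof. by rewrite -(oag_leM2rE y (x / y)) mulgVK mul1g. Qed.

Lemma oag_invg_le1 x : (x^-1 <= 1) = (1 <= x).
Proof. by rewrite -(oag_leM2rE x x^-1) mulVg mul1g. Qed.

Lemma oag_invg_lt1 x : (x^-1 < 1) = (1 < x).
Proof. by rewrite -(oag_ltM2rE x x^-1) mulVg mul1g. Qed.

Lemma oag_lteif_mul1 b b' x y :
  x < 1 ?<= if b -> y < 1 ?<= if b' -> x * y < 1 ?<= if b && b'.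
Proof.
rewrite -(oag_lteM2rE y x) mul1g; case: b b' => -[] /=.
- exact: le_trans.
- exact: le_lt_trans.
- exact: lt_le_trans.
- exact: lt_trans.
Qed.

End OrderedGroup.

(** * Farkas' lemma for a bounded valuation *)

Section Valuations.
Context {K : realType} {R : subringClosed K}.
Variables (S : expModule R) (n : nat).
Local Notation L := (monomial S n).

Section ValuationTheory.
Variable v : bounded_RS_valuation S n.
Implicit Types m : L.

Lemma valuationM m m' : v (m * m')%g = (v m * v m')%g.
Proof. exact: gmulfM. Qed.

Lemma valuation1 : v 1%g = 1%g.
Proof. by apply: (mulgI (v 1%g)); rewrite -valuationM !mulg1. Qed.

Lemma valuationV m : v (m^-1)%g = ((v m)^-1)%g.
Proof. by apply: (mulgI (v m)); rewrite -valuationM !mulgV valuation1. Qed.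

Lemma valuation_leE m m' : (v m <= v m')%O <-> valuation_monoid v (m / m')%g.
Proof. by rewrite /valuation_monoid /= valuationM valuationV oag_div_le1. Qed.

Lemma valuation_const m : (val m).2 = 0 ->
  (v m <= 1%g)%O = ((val m).1 <= 1).
Proof.
move=> m0; have Sm : (val m).1 \in S by case/andP: (valP m).
pose const s (Ss : s \in S) : {s : K | s \in S} :=
  exist (fun s => s \in S) s Ss.
have [_ /(_ (const _ Sm) (const _ (expModule1 S))) /= <-] := bv_RS v.
have <- : m = monomial_const n (const _ Sm).
  by apply: val_inj; rewrite [LHS]surjective_pairing m0.
by rewrite -valuation1; congr (_ <= v _)%O; exact: val_inj.
Qed.

Lemma valuation_ltX r (Rr : r \in R) m : 0 < r ->
  (v m < 1%g)%O -> (v (monomial_pow Rr m) < 1%g)%O.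
Proof.
(* [m * m^(N r - 1) * (m^r)^(- N) = 1] with [N r >= 1]; note that [R] need not
   contain [1 / r]. *)
move=> r0 m1; have [vX _] := bv_RS v.
rewrite ltNge; apply/negP => mr1.
have [N rN] : exists N : nat, 1 <= N%:R * r.
  exists (Num.truncn r^-1).+1; rewrite -ler_pdivrMr// div1r ltW//.
  by rewrite truncnS_gt.
have RN : N%:R * r - 1 \in R by rewrite rpredB ?rpred1// rpredM// rpred_nat.
have RnN : N%:R \in R by rewrite rpred_nat.
have : (v (monomial_pow RnN (monomial_pow Rr m)^-1%g) <= 1%g)%O.
  by apply: vX; rewrite ?valuationV ?oag_invg_le1.
have : (v (monomial_pow RN m) <= 1%g)%O.
  by apply: vX; [rewrite subr_ge0|exact: ltW].
move=> h1 h2.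
have : (v (m * (monomial_pow RN m) *
    monomial_pow RnN (monomial_pow Rr m)^-1) < 1)%O%g.
  rewrite !valuationM; apply: (@oag_lteif_mul1 _ _ false true) => //.
  exact: (@oag_lteif_mul1 _ _ false true).
rewrite (_ : (_ * _)%g = 1%g) ?valuation1 ?ltxx//.
apply: val_inj => /=; congr pair.
  apply: (@ln_inj K); rewrite ?posrE ?ltr01 ?mulr_gt0 ?powR_gt0 ?invr_gt0
     ?monomial_coef_gt0 ?powR_gt0 ?monomial_coef_gt0//.
  rewrite !lnM ?posrE ?mulr_gt0 ?powR_gt0 ?invr_gt0 ?monomial_coef_gt0
     ?powR_gt0 ?monomial_coef_gt0//.
  rewrite !ln_powR lnV ?posrE ?powR_gt0 ?monomial_coef_gt0// ln_powR ln1.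
  by rewrite mulrN mulrA mulrBl mul1r [_ + (_ - _)]addrC subrK subrr.
rewrite scalerN scalerA scalerBl scale1r.
by rewrite [_ + (_ - _)]addrC subrK subrr.
Qed.

(** An inequality [m > 1] is passed on as [m^-1 < 1], so all constraints hold with [v] in place of
    the monomial functions. Products and positive powers preserve this, including strictness;
    elimination therefore ends in true constant inequalities, because [v] and the order of [K] agree
    on constants. *)
Lemma valuation_separation (F G : seq L) :
  (forall m, m \in F -> valuation_monoid v m) ->
  (forall m, m \in G -> ~ valuation_monoid v m) ->
  exists t, [/\ affine_space t, forall m, m \in F -> monomial_fun m t <= 1
    & forall m, m \in G -> 1 < monomial_fun m t].
Proof.
move=> FM GM.
have [|||p|t At tP] := @monomial_feasible _ _ S n
  (fun b m => v m < 1%g ?<= if b)%O _ _ _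
  ([seq (true, m) | m <- F] ++ [seq (false, m^-1%g) | m <- G]).
- by move=> b b' m m' *; rewrite valuationM oag_lteif_mul1.
- move=> [] m r Rr r0 /=; last exact: valuation_ltX.
  by have [vX _] := bv_RS v; apply: vX; exact: ltW.
(* The strict case [v m < 1] is the negation of [v m^-1 <= 1], whence the use of the inverse
   constant. *)
- move=> b m /[swap] m0; have mV0 : (val m^-1%g).2 = 0 by rewrite /= m0 oppr0.
  have := valuation_const m0; have := valuation_const mV0.
  rewrite valuationV oag_invg_le1 /=.
  rewrite invr_le1 ?unitfE ?monomial_neq0 ?monomial_coef_gt0//.
  by case: b => /=; rewrite ?ltNge => e e'; rewrite ?e ?e'.
- rewrite mem_cat => /orP[] /mapP[m ms ->] /=; first exact: FM.
  by rewrite valuationV oag_invg_lt1 ltNge; exact/negP/GM.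
exists t; split => // m ms.
  by apply: (tP (true, m)); rewrite mem_cat map_f.
rewrite -invf_lt1 ?monomial_fun_gt0// -monomial_funV//.
apply: (tP (false, m^-1%g)); rewrite mem_cat; apply/orP; right.
by apply: (map_f (fun m : L => (false, m^-1%g))).
Qed.

End ValuationTheory.

Lemma val_equivP (v w : bounded_RS_valuation S n) :
  val_equiv v w <-> valuation_monoid v = valuation_monoid w.
Proof.
split=> [vw|vw m m'].
  apply/seteqP; split => m /=;
  by rewrite /valuation_monoid /= -(valuation1 v) -(valuation1 w) vw.
by apply/idP/idP => /valuation_leE h; apply/valuation_leE; move: h; rewrite vw.
Qed.

End Valuations.

(** * Quasi-nets *)

Lemma near_finite_set (T : Type) (I : choiceType) (F : set_system T) (D : set I)
    (P : I -> T -> Prop) : Filter F -> finite_set D ->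
  (forall i, D i -> \forall x \near F, P i x) ->
  \forall x \near F, forall i, D i -> P i x.
Proof.
move=> FF /finite_fsetP[X ->] XP.
by apply: filterS (@filter_bigI T I X P F FF _) => [x PX i /PX//|i /XP].
Qed.

Section QuasiNets.
Context {K : realType} {n : nat}.
Local Notation V := 'rV[K]_n.
Implicit Types (U W P Q : set V) (D : set (set V)).

Lemma quasi_net1 U D : (forall W, D W -> W `<=` U) ->
  (forall t, U t -> exists W, [/\ D W, W t & within U (nbhs t) W]) ->
  quasi_net U D.
Proof.
move=> DU UD; split => // t /UD[W [DW Wt UW]]; exists [set W].
by split => [|? -> //|? -> //|]; rewrite ?bigcup_set1//; exact: finite_set1.
Qed.

(** Near [t], finitely many members of [D] through [t] cover [U], and each of them is covered near
    [t] by finitely many members of its own net. *)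
Lemma quasi_net_trans U D (E : set V -> set (set V)) :
  quasi_net U D -> (forall W, D W -> quasi_net W (E W)) ->
  quasi_net U (\bigcup_(W in D) E W).
Proof.
move=> [DU UD] DE; split => [Q [W DW EQ]|t /UD[F [Ffin FD Ft UF]]].
  by apply: subset_trans (DU _ DW); have [+ _] := DE _ DW; exact.
pose good W G := F W -> [/\ finite_set G, G `<=` E W, forall Q, G Q -> Q t
  & within W (nbhs t) (\bigcup_(Q in G) Q)].
have [W|G GP] := @choice _ _ good.
  have [FW|FW] := pselect (F W); last by exists set0.
  by have [_ /(_ t (Ft _ FW))[GW ?]] := DE _ (FD _ FW); exists GW.
exists (\bigcup_(W in F) G W); split.
- by apply: bigcup_finite => // W /GP[].
- by move=> Q [W FW GQ]; exists W; [exact: FD|have [_ + _ _] := GP _ FW; exact].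
- by move=> Q [W /GP[_ _ + _]]; exact.
have WG : \forall y \near nbhs t, forall W, F W -> W y ->
    (\bigcup_(Q in G W) Q) y.
  by apply: near_finite_set => // W /GP[].
rewrite /within /= in UF *.
move: UF WG; apply: filterS2 => y UFy WGy /UFy[W FW Wy].
by have [Q GQ Qy] := WGy _ FW Wy; exists Q => //; exists W.
Qed.

Lemma quasi_netI U W D E : quasi_net U D -> quasi_net W E ->
  quasi_net (U `&` W) [set P `&` Q | P in D & Q in E].
Proof.
move=> [DU UD] [EW WE]; split => [_ [P DP] [Q EQ] <-|t [/UD + /WE]].
  by apply: setISS; [exact: DU|exact: EW].
move=> [F [Ffin FD Ft UF]] [G [Gfin GE Gt WG]].
exists [set P `&` Q | P in F & Q in G]; split.
- exact: finite_image2.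
- by move=> _ [P /FD DP] [Q /GE EQ] <-; exists P => //; exists Q.
- by move=> _ [P /Ft DP] [Q /Gt EQ] <-.
rewrite /within /= in UF WG *.
move: UF WG; apply: filterS2 => y UFy WGy [/UFy[P FP Py] /WGy[Q GQ Qy]].
by exists (P `&` Q) => //; exists P => //; exists Q.
Qed.

(** Every point of [P] has a finite subfamily of [D] that covers [U] near it, and so does any larger
    one. Compactness is used in its near-covering form, the parameter being a finite subfamily that
    grows along the filter [Phi]. *)
Lemma compact_quasi_net U D P : quasi_net U D -> compact P -> P `<=` U ->
  exists F, [/\ finite_set F, F `<=` D & P `<=` \bigcup_(W in F) W].
Proof.
move=> [DU UD] /compact_near_coveringP cP PU.
pose finD : set (set (set V)) := [set F | finite_set F /\ F `<=` D].
pose Phi : set_system (set (set V)) :=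
  filter_from finD (fun F => [set G | finD G /\ F `<=` G]).
have PhiF : Filter Phi.
  apply: filter_from_filter.
    by exists set0; split => //; exact: finite_set0.
  move=> F G [Ffin FD] [Gfin GD]; exists (F `|` G).
    by split; rewrite ?finite_setU// subUset.
  by move=> H [finH]; rewrite subUset => -[].
have [|F finF] := cP _ Phi (fun F y => U y -> (\bigcup_(W in F) W) y) _.
  move=> t /PU/UD[F [Ffin FD Ft UF]].
  exists (\bigcup_(W in F) W `|` ~` U, [set G | finD G /\ F `<=` G]) => /=.
    split; last by exists F.
    move: UF; rewrite /within /=; apply: filterS => y /= UFy.
    by have [/UFy|] := pselect (U y); [left|right].
  move=> [y G] /= [[[W FW Wy]|nUy] [_ FG]] Uy; last by have := nUy Uy.
  by exists W => //; exact: FG.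
(* [F] belongs to its own tail, so [FP] applies to [F] itself. *)
move=> FP; have [??] := finF; exists F; split => // y Py.
exact: (FP F (conj finF (@subset_refl _ F)) y Py (PU _ Py)).
Qed.

End QuasiNets.

(** * Polytopes and half-spaces *)

(** Half-spaces are closed in the positive orthant but not in general in the whole vector space, so
    [H] is only required to be closed relative to [P]. *)
Lemma compact_setI_near (T : topologicalType) (P H : set T) : compact P ->
  (forall t, P t -> ~ H t -> \forall y \near t, P y -> ~ H y) ->
  compact (P `&` H).
Proof.
move=> cP PH F FF FPH.
have [|t [Pt Ft]] := cP F FF; first by apply: filterS FPH => y [].
exists t; split => //; split => //; apply: contrapT => /(PH _ Pt) nHt.
by have [y [[Py Hy] /(_ Py)]] := Ft _ _ FPH nHt.
Qed.

Lemma powR_continuous_at (K : realType) (a x : K) : 0 < x ->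
  (y `^ a) @[y --> x] --> x `^ a.
Proof.
move=> x0; rewrite {2}/powR gt_eqF//.
have : expR (a * ln y) @[y --> x] --> expR (a * ln x).
  apply: continuous_cvg; first exact: continuous_expR.
  by apply: cvgMl_tmp; exact: continuous_ln.
(* [powR] is defined separately at base 0, and agrees with [expR (a * ln y)] near the positive
   [x]. *)
apply: cvg_trans; apply: near_eq_cvg.
near=> y; rewrite /powR gt_eqF//.
by near: y; exact: lt_nbhsr.
Unshelve. all: by end_near. Qed.

Lemma affine_space_nbhs (K : realType) n (t : 'rV[K]_n) :
  affine_space t -> nbhs t (@affine_space K n).
Proof.
move=> At.
have tA i : \forall y \near t, 0 < (y : 'rV[K]_n) ord0 i.
  apply: (@cvgr_gt _ _ (nbhs t) _ (fun y : 'rV_n => y ord0 i) (t ord0 i)).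
    exact: coord_continuous.
  exact: At.
exact: (@filter_forall _ _ _ (nbhs t) _ tA).
Qed.

Lemma monomial_fun_continuous_at (K : realType) (R : subringClosed K)
    (S : expModule R) n (m : monomial S n) (t : 'rV[K]_n) :
  affine_space t -> monomial_fun m y @[y --> t] --> monomial_fun m t.
Proof.
move=> At.
have powC i : (y : 'rV[K]_n) ord0 i `^ (val m).2 ord0 i @[y --> t] -->
    t ord0 i `^ (val m).2 ord0 i.
  apply: (@cvg_comp _ _ _ (fun y : 'rV[K]_n => y ord0 i) (fun x => x `^ _)).
    exact: coord_continuous.
  exact: powR_continuous_at.
have := @cvg_big K _ *%R 1 xpredT (@mul_continuous K) _ (nbhs t) (index_enum _)
  (fun i (y : 'rV[K]_n) => y ord0 i `^ (val m).2 ord0 i) _ _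
  (fun i _ => powC i).
by move=> prodC; exact: (cvgMl_tmp (prodC _)).
Qed.

Section Cells.
Context {K : realType} {R : subringClosed K}.
Variables (S : expModule R) (n : nat).
Hypothesis S_nontrivial : exists2 s : K, s \in S & s != 1.
Local Notation V := 'rV[K]_n.
Local Notation L := (monomial S n).
Local Notation A := (@affine_space K n).
Implicit Types (m : L) (t : V) (F : seq L) (U W P Q : set V).

(** An element of [S] other than 1, or its inverse, exceeds 1; its natural powers stay in [S], as
    [R] contains the integers, and are unbounded. *)
Lemma expModule_unbounded (c : K) : exists2 s, s \in S & c < s.
Proof.
have [s Ss s1] : exists2 s, s \in S & 1 < s.
  have [s Ss] := S_nontrivial; have s0 := expModule_gt0 Ss.
  rewrite neq_lt => /orP[s1|]; last by exists s.
  by exists s^-1; [exact: expModuleV|rewrite invf_gt1].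
have [c0|c0] := leP c 0.
  by exists 1; [exact: expModule1|exact: le_lt_trans ltr01].
pose N := (Num.truncn (ln c / ln s)).+1.
exists (s `^ N%:R); first by apply: expModuleX => //; exact: rpred_nat.
rewrite /powR gt_eqF ?(lt_trans ltr01)// -[ltLHS]lnK ?posrE// ltr_expR.
by rewrite -ltr_pdivrMr ?ln_gt0// truncnS_gt.
Qed.

(** These are the polyhedra; the polytopes are the compact ones. *)
Definition cell F : set V :=
  A `&` [set t | forall m, m \in F -> monomial_fun m t <= 1].
Definition halfspace m : set V := A `&` [set t | monomial_fun m t <= 1].

Lemma cell_affine F : cell F `<=` A. Proof. by move=> t []. Qed.

Lemma cell1 m : cell [:: m] = halfspace m.
Proof.
apply/seteqP; split => t [At mt]; split => //.
  by apply: mt; rewrite mem_head.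
by move=> m'; rewrite inE => /eqP ->.
Qed.

Lemma cell_cat F F' : cell (F ++ F') = cell F `&` cell F'.
Proof.
apply/seteqP; split => t.
  by move=> [At mt]; split; split => // m mF; apply: mt;
    rewrite mem_cat mF ?orbT.
move=> [[At mt] [_ mt']]; split => // m.
by rewrite mem_cat => /orP[/mt//|/mt'//].
Qed.

Lemma cell_cons m F : cell (m :: F) = halfspace m `&` cell F.
Proof. by rewrite -cell1 -cell_cat. Qed.

Lemma halfspace_gt_near m t : A t -> ~ halfspace m t ->
  \forall y \near t, ~ halfspace m y.
Proof.
move=> At /not_andP[//|/negP]; rewrite -ltNge => mt.
have : nbhs t [set y | 1 < monomial_fun m y].
  apply: (@cvgr_gt _ _ (nbhs t) _ (monomial_fun m) (monomial_fun m t)) => //.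
  exact: monomial_fun_continuous_at.
by apply: filterS => y /= my [_ /=]; rewrite leNgt my.
Qed.

Lemma halfspace_lt_near m t : A t -> monomial_fun m t < 1 ->
  nbhs t (halfspace m).
Proof.
move=> At mt.
have : nbhs t [set y | monomial_fun m y < 1].
  apply: (@cvgr_lt _ _ (nbhs t) _ (monomial_fun m) (monomial_fun m t)) => //.
  exact: monomial_fun_continuous_at.
move: (affine_space_nbhs At); apply: filterS2 => y Ay my.
by split => //; exact: ltW.
Qed.

Lemma compact_cellI P F : P `<=` A -> compact P -> compact (P `&` cell F).
Proof.
move=> PA cP; elim: F => [|m F IH].
  rewrite (_ : cell [::] = A); first by rewrite (setIidl PA).
  by apply/seteqP; split => [t []|t At].
rewrite cell_cons setIC -setIA (setIC (cell F)) setIC.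
apply: compact_setI_near => // t [/PA At _] /(halfspace_gt_near At).
by apply: filterS.
Qed.

Lemma polytopeI P Q : polytope S P -> polytope S Q -> polytope S (P `&` Q).
Proof.
move=> [cP [F PE]] [cQ [F' QE]]; rewrite -/(cell F) -/(cell F') in PE QE.
split; last by exists (F ++ F'); rewrite PE QE -cell_cat.
by rewrite QE; apply: compact_cellI => //; rewrite PE; exact: cell_affine.
Qed.

Lemma coord_monomial_subproof (i : 'I_n) :
  is_monomial S ((1, delta_mx ord0 i) : K * V).
Proof.
rewrite /is_monomial expModule1 /=; apply/mxOverP => j k; rewrite mxE.
exact: rpred_nat.
Qed.

Definition coord_monomial i : L := Monomial (coord_monomial_subproof i).

Lemma coord_monomialE i t : A t -> monomial_fun (coord_monomial i) t = t ord0 i.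
Proof.
move=> At; rewrite /monomial_fun /= mul1r (bigD1 i)//= mxE !eqxx powRr1 ?ltW//.
rewrite big1 ?mulr1// => j /negPf ji.
by rewrite mxE eqxx ji powRr0.
Qed.

Lemma monomial_fun_div_const m (s : {s : K | s \in S}) t : A t ->
  (monomial_fun (m / monomial_const n s)%g t <= 1) =
  (monomial_fun m t <= val s).
Proof.
move=> At; rewrite monomial_funM// monomial_funV// monomial_fun_const.
by rewrite ler_pdivrMr ?mul1r//; exact: expModule_gt0 (valP s).
Qed.

Definition coord_monomials : seq L :=
  [seq coord_monomial i | i <- enum 'I_n] ++
  [seq (coord_monomial i)^-1%g | i <- enum 'I_n].

(** The cube from [s^-1] to [s] in each coordinate. Adding its inequalities to a list makes the cell
    compact, which replaces polyhedra by polytopes. *)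
Definition box (s : {s : K | s \in S}) : seq L :=
  [seq (m / monomial_const n s)%g | m <- coord_monomials].

Lemma boxP s t : A t ->
  cell (box s) t <-> forall i, (val s)^-1 <= t ord0 i <= val s.
Proof.
have s0 : 0 < val s by exact: expModule_gt0 (valP s).
move=> At; split => [[_ st] i|st].
  have /st : (coord_monomial i / monomial_const n s)%g \in box s.
    by apply: map_f; rewrite mem_cat map_f// mem_enum.
  have /st : ((coord_monomial i)^-1 / monomial_const n s)%g \in box s.
    apply: map_f; rewrite mem_cat; apply/orP; right.
    by apply: (map_f (fun i => (coord_monomial i)^-1%g)); rewrite mem_enum.
  rewrite !monomial_fun_div_const// monomial_funV// coord_monomialE//.
  by rewrite invf_ple ?posrE// => -> ->.
split => // _ /mapP[m + ->]; rewrite mem_cat => /orP[] /mapP[i _ ->];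
  rewrite monomial_fun_div_const// ?monomial_funV// coord_monomialE//.
  by have /andP[] := st i.
by have /andP[] := st i; rewrite invf_ple ?posrE.
Qed.

Lemma compact_box s : compact (cell (box s)).
Proof.
have s0 : 0 < val s by exact: expModule_gt0 (valP s).
pose I := `[(val s)^-1, val s]%classic.
rewrite (_ : cell _ = [set t : V | forall i, I (t ord0 i)]).
  by apply: (@rV_compact K n (fun=> I)) => i; exact: segment_compact.
apply/seteqP; split => t /=.
  by move=> st i; rewrite /I /= in_itv /=; move: i; apply/boxP => //; case: st.
move=> st; have At : A t.
  move=> i; have := st i; rewrite /I /= in_itv /= => /andP[+ _].
  by apply: lt_le_trans; rewrite invr_gt0.
by apply/boxP => // i; have := st i; rewrite /I /= in_itv.
Qed.

Lemma polytope_box s : polytope S (cell (box s)).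
Proof. by split; [exact: compact_box|exists (box s)]. Qed.

Lemma box_nbhs t : A t -> exists s, nbhs t (cell (box s)).
Proof.
move=> At.
(* The sum dominates every [t_i] and every [t_i^-1], so a single [s] bounds them all strictly, and
   strict bounds persist near [t]. *)
have [s Ss st] := expModule_unbounded (\sum_(i < n) (t ord0 i + (t ord0 i)^-1)).
pose s' : {s : K | s \in S} := exist (fun s => s \in S) s Ss.
exists s'.
have ts i : monomial_fun (coord_monomial i) t < s /\
    monomial_fun (coord_monomial i)^-1%g t < s.
  have ti0 : 0 < t ord0 i by exact: At.
  have : t ord0 i + (t ord0 i)^-1 < s.
    apply: le_lt_trans st; rewrite (bigD1 i)//= lerDl sumr_ge0// => j _.
    by rewrite addr_ge0// ?invr_ge0 ltW//; exact: At.
  rewrite monomial_funV// coord_monomialE// => tis.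
  by split; apply: le_lt_trans tis; rewrite ?lerDl ?lerDr ?invr_ge0 ltW.
have : nbhs t [set y | forall m, m \in coord_monomials -> monomial_fun m y < s].
  apply: (@near_finite_set V L (nbhs t) [set` coord_monomials]
    (fun m y => monomial_fun m y < s) _ (finite_seq _)) => m.
  rewrite /= mem_cat => mc.
  apply: (@cvgr_lt _ _ (nbhs t) _ (monomial_fun m) (monomial_fun m t)).
    exact: monomial_fun_continuous_at.
  by case/orP: mc => /mapP[i _ ->]; have [] := ts i.
move: (affine_space_nbhs At); apply: filterS2 => y Ay sy.
split => // _ /mapP[m mc ->].
by rewrite monomial_fun_div_const// ltW// sy.
Qed.

Lemma PL_subspaceP U : U `<=` A ->
  (forall t, U t ->
    exists Q, [/\ polytope S Q, Q `<=` U, Q t & within U (nbhs t) Q]) ->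
  PL_subspace S U.
Proof.
move=> UA UQ; split => //.
apply: quasi_net1 => [W []//|t /UQ[Q [pQ QU Qt UQt]]].
by exists Q.
Qed.

Lemma PL_subspaceI U W : PL_subspace S U -> PL_subspace S W ->
  PL_subspace S (U `&` W).
Proof.
move=> [UA Un] [WA Wn]; split; first by move=> t [/UA].
have [_ UWn] := quasi_netI Un Wn; split => [P []//|t /UWn[F [Ffin FD Ft UF]]].
exists F; split => // _ /FD[P [pP PU] [Q [pQ QW] <-]].
by split; [exact: polytopeI|exact: setISS].
Qed.

Lemma within_setT_nbhs U W t : nbhs t W -> within U (nbhs t) W.
Proof. by rewrite /within /=; apply: filterS. Qed.

Lemma PL_polytope P : polytope S P -> PL_subspace S P.
Proof.
move=> pP; have [_ [F PE]] := pP.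
apply: PL_subspaceP => [|t Pt]; first by rewrite PE => t [].
by exists P; split => //; exact: withinT.
Qed.

Lemma PL_affine : PL_subspace S A.
Proof.
apply: PL_subspaceP => // t At; have [s ts] := box_nbhs At.
exists (cell (box s)); split; [exact: polytope_box|exact: cell_affine| |].
  exact: nbhs_singleton.
exact: within_setT_nbhs.
Qed.

Lemma PL_halfspace m : PL_subspace S (halfspace m).
Proof.
apply: PL_subspaceP => [t []//|t [At mt]]; have [s ts] := box_nbhs At.
(* Cutting with a box around [t] yields a polytope and does not change the half-space near [t]. *)
exists (cell (box s) `&` halfspace m); split.
- split; last by exists (box s ++ [:: m]); rewrite -cell1 -cell_cat.
  rewrite -cell1; apply: compact_cellI; first exact: cell_affine.
  exact: compact_box.
- by move=> y [].
- by split => //; exact: nbhs_singleton.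
- by move: ts; rewrite /within /=; apply: filterS.
Qed.

End Cells.

(** * Points and valuations *)

Section Points.
Context {K : realType} {R : subringClosed K}.
Variables (S : expModule R) (n : nat).
Hypothesis S_nontrivial : exists2 s : K, s \in S & s != 1.
Local Notation V := 'rV[K]_n.
Local Notation L := (monomial S n).
Local Notation A := (@affine_space K n).
Implicit Types (m : L) (t : V) (F : seq L) (U W P Q : set V).

Lemma PL_monomial U m : PL_subspace S U -> PL_function S U (monomial_fun m).
Proof.
move=> [_]; rewrite /PL_function.
suff -> : [set P | polytope S P /\ P `<=` U] =
  [set P | [/\ polytope S P, P `<=` U & exists m' : L,
    forall t, P t -> monomial_fun m t = monomial_fun m' t]] by [].
by apply/seteqP; split => P [] // pP PU; split => //; exists m.
Qed.

(** * From a point to its valuation *)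

Section PointTheory.
Variables (x : set (set V)) (xP : AG_point S x).

Lemma AG_point_affine : x A.
Proof.
have [U xU] := AG_point_nonempty xP; have [UA _] := AG_point_PL xP xU.
exact: (AG_point_up xP xU (PL_affine n S_nontrivial)).
Qed.

Lemma AG_point_le U m : x U -> (forall t, U t -> monomial_fun m t <= 1) ->
  x (halfspace m).
Proof.
move=> xU Um; apply: (AG_point_up xP xU); first exact: PL_halfspace.
by have [UA _] := AG_point_PL xP xU => t Ut; split; [exact: UA|exact: Um].
Qed.

(** A section representing the germ of [m] is at most 1 and agrees with [m] on a member of [x], so
    the half-space contains that member. Conversely [m] is itself a section over its half-space. *)
Lemma stalk_monoidE m : stalk_monoid S x m <-> x (halfspace m).
Proof.
have xA := AG_point_affine; split.
  move=> [U [f [xU [_ f1] gE]]].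
  (* The pair [(A, monomial_fun m)] lies in its own germ; read in the germ of [f], this gives the
     member [W] where the two functions agree. *)
  have : germ x U f (A, monomial_fun m).
    by rewrite -gE; split => //; exists A; split.
  move=> [_ [W [xW WU _ fm]]]; apply: (AG_point_le xW) => t Wt.
  have /= <- := fm _ Wt; by have /andP[] := f1 _ (WU _ Wt).
move=> xm; exists (halfspace m), (monomial_fun m); split => //.
  split; first exact/PL_monomial/PL_halfspace.
  by move=> t [At mt]; apply/andP; split => //; exact: monomial_fun_gt0.
apply/seteqP; split => -[U f] /= [xU [W [xW WA WU Wf]]]; split => //.
  exists (W `&` halfspace m); split; first exact: (AG_pointI xP).
  - by move=> t [].
  - by move=> t [/WU].
  - by move=> t [/Wf].
by exists W; split => // t /WA[].
Qed.

Lemma AG_point_total m : x (halfspace m) \/ x (halfspace m^-1%g).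
Proof.
pose D := [set W | W = halfspace m \/ W = halfspace m^-1%g].
have [||W [->|->] xW] := AG_point_covering xP (U := A) (D := D).
- exact: AG_point_affine.
- have mV t : A t -> halfspace m t \/ halfspace m^-1%g t.
    move=> At; have [mt|mt] := leP (monomial_fun m t) 1; first by left.
    right; split => //=.
    by rewrite monomial_funV// invf_le1 ?monomial_fun_gt0// ltW.
  split.
  + by move=> W [] ->; exact: PL_halfspace.
  + apply/seteqP; split => [t [W [] -> []//]|t At].
    have [tm|tm] := mV _ At; first by exists (halfspace m) => //; left.
    by exists (halfspace m^-1%g) => //; right.
  split => [W [] -> t []//|t At].
  (* A half-space missing [t] misses a neighbourhood of [t], so those through [t] already cover [A]
     near [t]. *)
  exists [set W | D W /\ W t]; split.
  + by apply: finite_setIl; exact: finite_set2.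
  + by move=> W [].
  + by move=> W [].
  have mnear (m' : L) : nbhs t [set y | ~ halfspace m' t -> ~ halfspace m' y].
    have [mt|mt] := pselect (halfspace m' t).
      by apply: (@filterS _ (nbhs t) _ setT) filterT => y _ /= /(_ mt).
    by apply: filterS (halfspace_gt_near At mt) => y /= yNm _.
  move: (mnear m) (mnear m^-1%g); rewrite /within /=.
  apply: filterS2 => y /= h1 h2 /mV[ym|ym].
    exists (halfspace m) => //; split; first by left.
    by apply: contrapT => /h1.
  exists (halfspace m^-1%g) => //; split; first by right.
  by apply: contrapT => /h2.
- by left.
- by right.
Qed.

Lemma AG_point_mul m m' : x (halfspace m) -> x (halfspace m') ->
  x (halfspace (m * m')%g).
Proof.
move=> xm xm'.
apply: (AG_point_le (AG_pointI xP xm xm')) => t [[At mt] [_ mt']].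
by rewrite monomial_funM// mulr_ile1// ltW// monomial_fun_gt0.
Qed.

Lemma AG_point_pow r (Rr : r \in R) m : 0 <= r -> x (halfspace m) ->
  x (halfspace (monomial_pow Rr m)).
Proof.
move=> r0 xm; apply: (AG_point_le xm) => t [At mt].
have <- : 1 `^ r = 1 :> K by rewrite powR1.
by rewrite monomial_funX// ge0_ler_powR// nnegrE ltW// monomial_fun_gt0.
Qed.

Lemma AG_point_const (s : {s : K | s \in S}) :
  x (halfspace (monomial_const n s)) <-> val s <= 1.
Proof.
split => [xs|s1]; last first.
  by apply: (AG_point_le AG_point_affine) => t _; rewrite monomial_fun_const.
rewrite leNgt; apply/negP => s1; apply: (AG_point_proper xP).
rewrite -(_ : halfspace (monomial_const n s) = set0)// -subset0 => t [_ /=].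
by rewrite monomial_fun_const leNgt s1.
Qed.

(** Once [s] exceeds the value of [m] at [t], the half-space [m <= s] is a neighbourhood of [t]. So
    these half-spaces form an admissible covering of [A]. *)
Lemma AG_point_bounded m :
  exists s, x (halfspace (m / monomial_const n s)%g).
Proof.
pose H (s : {s : K | s \in S}) := halfspace (m / monomial_const n s)%g.
have near_H t : A t -> exists s, nbhs t (H s).
  move=> At.
  have [s Ss ms] := expModule_unbounded S_nontrivial (monomial_fun m t).
  exists (exist (fun s => s \in S) s Ss); apply: halfspace_lt_near => //.
  rewrite monomial_funM// monomial_funV// monomial_fun_const.
  rewrite ltr_pdivrMr ?mul1r//.
  exact: (expModule_gt0 Ss).
have [||W [s _ <-] xs] := AG_point_covering xP (U := A) (D := range H).
- exact: AG_point_affine.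
- split => [_ [s _ <-]||]; first exact: PL_halfspace.
  + apply/seteqP; split => [t [_ [s _ <-] []]//|t At].
    have [s ts] := near_H _ At; exists (H s); first by exists s.
    exact: nbhs_singleton.
  apply: quasi_net1 => [_ [s _ <-] t []//|t At].
  have [s ts] := near_H _ At; exists (H s).
  by split; [exists s|exact: nbhs_singleton|exact: within_setT_nbhs].
by exists s.
Qed.

Lemma AG_point_cell F : (forall m, m \in F -> x (halfspace m)) -> x (cell F).
Proof.
elim: F => [_|m F IH mF].
  rewrite (_ : cell [::] = A); first exact: AG_point_affine.
  by apply/seteqP; split => [t []|t At].
rewrite cell_cons; apply: (AG_pointI xP); first by apply: mF; rewrite mem_head.
by apply: IH => m' m'F; apply: mF; rewrite inE m'F orbT.
Qed.

(** The polytopes in [U] form an admissible covering of [U], so one of them is in [x], and with it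
    the half-spaces that cut it out. Hence the half-spaces in [x] determine [x], which gives
    injectivity. *)
Lemma AG_pointE U : x U <-> PL_subspace S U /\
  exists F, [/\ forall m, m \in F -> x (halfspace m), compact (cell F)
    & cell F `<=` U].
Proof.
split => [xU|[PLU [F [/AG_point_cell xF _ FU]]]]; last first.
  exact: (AG_point_up xP xF).
have PLU := AG_point_PL xP xU; split => //; have [UA netU] := PLU.
have [||P [[cP [F PE]] PU] xP'] := AG_point_covering xP (U := U)
  (D := [set P | polytope S P /\ P `<=` U]).
- exact: xU.
- split => // [P [/PL_polytope]//|].
  apply/seteqP; split => [t [P [_ +]]|t Ut]; first exact.
  have [_ /(_ _ Ut)[G [_ GD Gt UG]]] := netU.
  by have [P GP Pt] := nbhs_singleton UG Ut; exists P => //; exact: GD.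
rewrite -/(cell F) in PE; exists F; rewrite -PE; split => // m mF.
by apply: (AG_point_le xP') => t; rewrite PE => -[_]; exact.
Qed.

(** A list of scalars avoids the type of matrices, so it can serve as the code of a representative
    in the value group. *)
Definition monomial_code m : seq K :=
  (val m).1 :: [seq (val m).2 ord0 i | i <- enum 'I_n].

Lemma monomial_code_inj : injective monomial_code.
Proof.
move=> m m' [m1 /eq_in_map m2]; apply: val_inj.
rewrite [LHS]surjective_pairing [RHS]surjective_pairing m1; congr pair.
by apply/rowP => i; apply: m2; rewrite mem_enum.
Qed.

Definition stalk_total_submonoid : total_submonoid L (seq K) :=
  @TotalSubmonoid _ _ (fun m => x (halfspace m)) (@monomial_mulgC _ _ S n)
    AG_point_mul AG_point_total _ monomial_code_inj.

Local Notation pi := (ts_pi stalk_total_submonoid).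

Lemma stalk_pi_le m m' : (pi m <= pi m')%O <-> x (halfspace (m / m')%g).
Proof. by rewrite ts_pi_le; split => /asboolP. Qed.

Lemma stalk_pi_RS : RS_valuation pi.
Proof.
split => [r Rr m r0 /ts_pi_le1 m1|s s'].
  by apply/ts_pi_le1; exact: AG_point_pow.
have ss' : val s / val s' \in S.
  by apply: expModuleM; [exact: valP|apply: expModuleV; exact: valP].
have s'0 : 0 < val s' by exact: expModule_gt0 (valP s').
pose q : {s : K | s \in S} := exist (fun s => s \in S) _ ss'.
have qE : (monomial_const n s / monomial_const n s')%g =
    monomial_const n q :> L.
  by apply: val_inj; rewrite /= subr0.
have sE : (val s <= val s') = (val q <= 1) by rewrite /= ler_pdivrMr// mul1r.
apply/idP/idP => [/stalk_pi_le|]; first by rewrite qE sE => /AG_point_const.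
by rewrite sE => q1; apply/stalk_pi_le; rewrite qE; exact/AG_point_const.
Qed.

Lemma stalk_pi_bounded : bounded_valuation pi.
Proof.
by move=> m; have [s xs] := AG_point_bounded m; exists s; exact/stalk_pi_le.
Qed.

Definition stalk_valuation : bounded_RS_valuation S n :=
  BoundedRSValuation stalk_pi_RS stalk_pi_bounded.

Lemma stalk_valuationE : valuation_monoid stalk_valuation = stalk_monoid S x.
Proof.
apply/seteqP; split => m; rewrite /valuation_monoid /=.
  by move=> /ts_pi_le1 ?; apply/stalk_monoidE.
by move=> /stalk_monoidE ?; apply/ts_pi_le1.
Qed.

End PointTheory.

Lemma AG_point_sub (x y : set (set V)) : AG_point S x -> AG_point S y ->
  stalk_monoid S x `<=` stalk_monoid S y -> x `<=` y.
Proof.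
move=> xP yP xy U /(AG_pointE xP)[PLU [F [Fx cF FU]]].
apply/(AG_pointE yP); split => //; exists F; split => // m /Fx.
by move=> /(stalk_monoidE xP)/xy/(stalk_monoidE yP).
Qed.

(** * From a valuation to its point *)

Section ValuationPoint.
Variable v : bounded_RS_valuation S n.
Local Notation M := (valuation_monoid v).

Definition valuation_point : set (set V) :=
  [set U | PL_subspace S U /\
    exists F, [/\ forall m, m \in F -> M m, compact (cell F) & cell F `<=` U]].

(** Since [v] is increasing on [S], the larger of two bounding constants serves for both. *)
Lemma valuation_bounded_seq F :
  exists s, forall m, m \in F -> M (m / monomial_const n s)%g.
Proof.
elim: F => [|m F [s sF]]; first by exists (exist _ 1 (expModule1 S)).
have [s' /valuation_leE ms'] := bv_bounded v m.
have [_ vS] := bv_RS v.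
have [ss'|/ltW s's] := leP (val s) (val s').
  exists s' => m'; rewrite inE => /orP[/eqP -> //|/sF/valuation_leE m's].
  by apply/valuation_leE; rewrite (le_trans m's)// vS.
exists s => m'; rewrite inE => /orP[/eqP -> //|/sF//].
by apply/valuation_leE; apply: le_trans; [exact/valuation_leE/ms'|rewrite vS].
Qed.

(** A common bound for the coordinates and their inverses. It provides a compact cell cut out by
    elements of [M]. *)
Lemma valuation_box : exists s, forall m, m \in box n s -> M m.
Proof.
have [s sM] := valuation_bounded_seq (coord_monomials S n).
by exists s => _ /mapP[m /sM ? ->].
Qed.

Lemma valuation_point_AG_point : AG_point S valuation_point.
Proof.
split.
- by move=> U [].
- have [s sM] := valuation_box; exists A; split; first exact: PL_affine.
  by exists (box n s); split => //; [exact: compact_box|exact: cell_affine].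
(* Separation without strict inequalities: the cell of [F] has a point. *)
- move=> [_ [F [FM _]]].
  have [//|t [At tF _]] := @valuation_separation _ _ _ _ v F [::] FM.
  by move/(_ t); apply; split.
- move=> U W [_ [F [FM cF FU]]] PLW UW; split => //.
  by exists F; split => //; exact: subset_trans UW.
- move=> U W [PLU [F [FM cF FU]]] [PLW [G [GM cG GW]]].
  split; first exact: PL_subspaceI.
  exists (F ++ G); rewrite cell_cat; split; last exact: setISS.
    by move=> m; rewrite mem_cat => /orP[/FM|/GM].
  by apply: compact_cellI => //; exact: cell_affine.
move=> U D [PLU [F [FM cF FU]]] [DPL _ netD].
apply: contrapT => nD.
(* The covering is refined to polytopes inside its members, finitely many of which cover the compact
   cell of [F]. *)
have [|G [Gfin GD FG]] := compact_quasi_net _ cF FU (D := \bigcup_(W in D)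
  [set P | polytope S P /\ P `<=` W]).
  by apply: quasi_net_trans => // W /DPL[].
(* Each polytope [P] of [G] has a defining monomial outside [M]; otherwise [P] would put a member of
   [D] into the filter. Outside [G] the choice is the dummy [1]. *)
pose bad P m := G P -> P `<=` halfspace m /\ ~ M m.
have [P|c cP] := @choice _ _ bad.
  have [/GD[W DW [[cP [E PE]] PW]]|] := pselect (G P); last by exists 1%g.
  rewrite -/(cell E) in PE; apply: contrapT => nE; apply: nD; exists W => //.
  split; first exact: DPL; exists E; rewrite -PE; split => // m mE.
  apply: contrapT => mM; apply: nE; exists m; split => // t.
  rewrite PE => -[At Et].
  by split => //; exact: Et.
have /finite_seqP[s sE] := Gfin.
(* The resulting point lies in the cell of [F] but violates a defining inequality of every [P] in
   [G]. *)
have [||t [At tF tG]] := @valuation_separation _ _ _ _ v F [seq c P | P <- s].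
- exact: FM.
- move=> _ /mapP[P Ps ->]; have GP : G P by rewrite sE.
  by have [] := cP _ GP.
have [P GP Pt] : (\bigcup_(W in G) W) t by apply: FG; split.
have [PH _] := cP _ GP; have [_ /=] := PH _ Pt.
rewrite leNgt tG//; apply: map_f.
by move: GP; rewrite sE.
Qed.

Lemma valuation_point_stalk : stalk_monoid S valuation_point = M.
Proof.
apply/seteqP; split => m.
  move=> /(stalk_monoidE valuation_point_AG_point)[_ [F [FM _ Fm]]].
  apply: contrapT => mM.
  (* If [m] were not in [M], some point of the cell of [F] would lie outside the half-space of
     [m]. *)
  have [|t [At tF /(_ m)]] := @valuation_separation _ _ _ _ v F [:: m] FM.
    by move=> m'; rewrite inE => /eqP ->.
  have [_ /=] : halfspace m t by apply: Fm; split.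
  by rewrite mem_head ltNge => -> /(_ isT).
move=> Mm; apply/(stalk_monoidE valuation_point_AG_point).
have [s sM] := valuation_box; split; first exact: PL_halfspace.
exists (m :: box n s); split.
- by move=> m'; rewrite inE => /orP[/eqP ->//|/sM].
- rewrite cell_cons setIC -cell1; apply: compact_cellI.
    exact: cell_affine.
  exact: compact_box.
by rewrite cell_cons => t [].
Qed.

End ValuationPoint.

End Points.

Theorem theorem9p3p11 (K : realType) (R : subringClosed K) (S : expModule R)
    (n : nat) (S_nontrivial : exists2 s : K, s \in S & s != 1) :
  (forall x : set (set 'rV[K]_n), AG_point S x ->
     bounded_valuation_monoid (stalk_monoid S x)) /\
  set_bij [set x : set (set 'rV[K]_n) | AG_point S x]
    (range (@valuation_class K R S n))
    (fun x => [set v : bounded_RS_valuation S n |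
                 valuation_monoid v = stalk_monoid S x]).
Proof.
(* The fibres of [valuation_monoid] are the equivalence classes, so the map sends [x] to the class
   of its stalk valuation. *)
have classE (v : bounded_RS_valuation S n) (M : set (monomial S n)) :
    valuation_monoid v = M ->
    [set w : bounded_RS_valuation S n | valuation_monoid w = M] =
    valuation_class v.
  move=> <-; apply/seteqP; split => w /=; last by move=> /val_equivP.
  by move=> ?; apply/val_equivP.
have stalkV (x : set (set 'rV[K]_n)) (xP : AG_point S x) :=
  stalk_valuationE S_nontrivial xP.
split; first by move=> x xP; exists (stalk_valuation S_nontrivial xP).
split.
- move=> x xP; exists (stalk_valuation S_nontrivial xP) => //.
  by rewrite (classE _ _ (stalkV x xP)).
- move=> x y; rewrite !inE => xP yP xy.
  have xyM : stalk_monoid S x = stalk_monoid S y.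
    (* The fibre over the stalk of [x] is non-empty, so equal fibres force equal stalks. *)
    have : [set w : bounded_RS_valuation S n |
        valuation_monoid w = stalk_monoid S x]
      (stalk_valuation S_nontrivial xP) by exact: stalkV.
    by rewrite xy /= stalkV.
  by apply/seteqP; split; apply: (AG_point_sub S_nontrivial) => //; rewrite xyM.
move=> _ [v _ <-]; exists (valuation_point v).
  exact: valuation_point_AG_point.
by rewrite (classE v)// valuation_point_stalk.
Qed.
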